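(* Let $s>2$, let $a=\Delta^s_{a_1a_2\ldots a_n\ldots}$ with $(a_n)\in L$, and let $y_0=\Delta^{Q^*_s}_{b_1b_2\ldots b_n\ldots}$ with $(b_n)\in L$. The level set $f_a^{-1}(y_0)=\{x\in[0,1]: f_a(x)=y_0\}$ has the following structure: 1) it is empty if $b_n=s-1$ and $a_n\in\{1,2,\dots,s-2\}$ for some $n\in\mathbb{N}$; 2) it is finite if either the two conditions $a_n+b_n\in A$ and $a_n-b_n\in A$ hold simultaneously for only finitely many indices $n$, or $b_n=0$ for all $n\in\mathbb{N}$; 3) it is a continuum (has the cardinality of the continuum) if for infinitely many indices $n$ the three conditions $b_n\neq 0$, $a_n+b_n\in A$ and $a_n-b_n\in A$ hold simultaneously.
   Context: Let $s\ge 2$ be an integer, $A=\{0,1,\dots,s-1\}$, and $L=A\times A\times\cdots$ the set of infinite sequences with elements in $A$. Fix numbers $q_{in}$ ($i\in A$, $n\in\mathbb{N}=\{1,2,\dots\}$) with $0<q_{in}<1$, $q_{0n}+q_{1n}+\dots+q_{s-1,n}=1$ for every $n$, and $\prod_{n=1}^\infty\max_{i\in A} q_{in}=0$; moreover assume there are constants $\varepsilon,\delta$ with $0<\varepsilon<\min_i q_{in}$ and $\max_i q_{in}<\delta<1$ for all $n\in\mathbb{N}$. Put $\beta_{in}=\sum_{k=0}^{i-1}q_{kn}$ (so $\beta_{0n}=0$). For $(\alpha_n)\in L$ define $$\Delta^{Q^*_s}_{\alpha_1\alpha_2\ldots\alpha_n\ldots}=\beta_{\alpha_1 1}+\sum_{n=2}^\infty\Bigl(\beta_{\alpha_n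 n}\prod_{j=1}^{n-1}q_{\alpha_j j}\Bigr).$$ Every $x\in[0,1]$ equals $\Delta^{Q^*_s}_{\alpha_1\alpha_2\ldots}$ for some $(\alpha_n)\in L$, called a $Q^*_s$-representation of $x$. Parentheses denote a period. The numbers with two representations are exactly those of the form $\Delta^{Q^*_s}_{\alpha_1\ldots\alpha_{m-1}\alpha_m(0)}=\Delta^{Q^*_s}_{\alpha_1\ldots\alpha_{m-1}[\alpha_m-1](s-1)}$ with $\alpha_m\ge 1$ ($Q^*_s$-binary numbers); all other numbers of $[0,1]$ have a unique representation ($Q^*_s$-unary numbers). For $(a_n)\in L$ let $a=\Delta^s_{a_1a_2\ldots}=\sum_{n\ge1}a_n s^{-n}\in[0,1]$ be the number with this (fixed) $s$-adic digit sequence. The function $f_a:[0,1]\to[0,1]$ is $$f_a\bigl(\Delta^{Q^*_s}_{\alpha_1\alpha_2\ldots\alpha_n\ldots}\bigr)=\Delta^{Q^*_s}_{|a_1-\alpha_1|\,|a_2-\alpha_2|\ldots|a_n-\alpha_n|\ldots},$$ where for a $Q^*_s$-binary argument the formula is applied to its representation with period $(0)$, and for a $Q^*_s$-unary argument to its unique representation.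
   Formalization: Parts 1 and 3 are false as worded. In 1) the condition b_n=s-1, a_n in {1,...,s-2} for some n is required of every representation of y_0 (both, if y_0 is binary); in 3) the level set is additionally assumed nonempty. *)

(* Defs.v *)
(* MathComp-Analysis. *)
From mathcomp Require Import all_boot all_order all_algebra.
From mathcomp Require Import all_classical all_reals all_analysis.

Set Implicit Arguments.
Unset Strict Implicit.
Unset Printing Implicit Defensive.

Import Order.TTheory GRing.Theory Num.Theory.
Import numFieldNormedType.Exports.

Local Open Scope classical_set_scope.
Local Open Scope ring_scope.

(* The alphabet {0, ..., s - 1} is 'I_s. Positions are numbered from 0 instead
   of 1: an infinite word (alpha_1, alpha_2, ...) is a function
   alpha : nat -> 'I_s with alpha n standing for alpha_(n+1), and q i n stands
   for q_(i,n+1). *)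

Record Qstar_matrix (R : realType) (s : nat) (q : 'I_s -> nat -> R) : Prop := {
  Qstar_gt0 : forall i n, 0 < q i n ;
  Qstar_lt1 : forall i n, q i n < 1 ;
  Qstar_sum1 : forall n, \sum_(i < s) q i n = 1 ;
  Qstar_prod_max :
    (fun N : nat => \prod_(n < N) \big[Num.max/0]_(i < s) q i n) @ \oo --> (0 : R) ;
  (* The units 1 and 0 of min and max do not matter, since 0 < q i n < 1. *)
  Qstar_bounds : exists eps delta : R, [/\ 0 < eps, delta < 1 &
    forall n, eps < \big[Num.min/1]_(i < s) q i n /\
              \big[Num.max/0]_(i < s) q i n < delta]
}.

Section QRepresentation.
Context {R : realType} {s : nat}.
Variable q : 'I_s -> nat -> R.

Definition Qbeta (i : 'I_s) (n : nat) : R := \sum_(k < s | (k < i)%N) q k n.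

(* At n = 0 the product is empty, so the first term is beta_(alpha_1, 1). *)
Definition Qdelta (alpha : nat -> 'I_s) : R :=
  limn (series (fun n => Qbeta (alpha n) n * \prod_(j < n) q (alpha j) j)).

(* x = Delta_(alpha_1 ... alpha_m (0)) with alpha_m >= 1. *)
Definition Qbinary (x : R) : Prop :=
  exists alpha : nat -> 'I_s, Qdelta alpha = x /\
    exists m, (1 <= alpha m)%N /\ forall n, (m < n)%N -> alpha n = 0%N :> nat.

(* The representation on which f_a is evaluated: the one with period (0) when
   x is Q-binary, the unique one otherwise. *)
Definition Qcanonical (x : R) (alpha : nat -> 'I_s) : Prop :=
  Qdelta alpha = x /\
  (Qbinary x -> exists m, forall n, (m <= n)%N -> alpha n = 0%N :> nat).

Lemma digit_dist_subproof (i j : 'I_s) : (`|i%:Z - j%:Z| < s)%N.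
Proof.
have [ij|/ltnW ji] := leqP i j.
  by rewrite distnC distnEl // (leq_ltn_trans (leq_subr _ _)).
by rewrite distnEl // (leq_ltn_trans (leq_subr _ _)).
Qed.

Definition digit_dist (i j : 'I_s) : 'I_s := Ordinal (digit_dist_subproof i j).

(* f_a depends on the chosen digit sequence of a, so the parameter is that
   sequence. Every x in [0, 1] has a canonical representation, hence the
   default value a of xget is only taken outside [0, 1]. *)
Definition Qf (a : nat -> 'I_s) (x : R) : R :=
  let alpha := xget a (Qcanonical x) in
  Qdelta (fun n => digit_dist (a n) (alpha n)).

Definition Qlevel_set (a : nat -> 'I_s) (y : R) : set R :=
  [set x | 0 <= x <= 1 /\ Qf a x = y].

End QRepresentation.

Definition is_digit (s : nat) (z : int) : bool := (0 <= z) && (z < s%:Z).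

(* Main.v *)
Require Import Defs.
From mathcomp Require Import all_boot all_order all_algebra.
From mathcomp Require Import all_classical all_reals all_analysis.
From mathcomp Require Import zify lra.

Import Order.TTheory GRing.Theory Num.Theory.
Import numFieldNormedType.Exports.

Local Open Scope classical_set_scope.
Local Open Scope ring_scope.

(** The level set of [y] under [f_a] is governed by two facts.

    First, the digit words [c] with [Qdelta q c = y] are under control. The
    words sharing the first [n] digits of [c] are sent into the interval
    [[left_end c n, right_end c n]], whose width tends to 0, and the intervals
    of one generation overlap at most at endpoints. So two different words
    with the same value must reach opposite ends of their intervals: one ends
    in [s - 1] repeated, the other in [0] repeated ([Qdelta_eq_twin]). Hence
    [y] has at most two words ([finite_Qdelta_fiber]).

    Second, for a fixed word [c], solving [|a_n - alpha_n| = c_n] digit by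
    digit leaves the candidates [a_n + c_n] and [a_n - c_n], and a real choice
    remains exactly at the positions of [branching a c]: those where both
    candidates are digits and [c_n <> 0].

    Emptiness is immediate, since [|a_n - alpha_n| = s - 1] forces [a_n] to be
    an extreme digit. If only finitely many positions branch, only finitely
    many [alpha] remain ([finite_digit_dist_fiber]); this covers every word of
    [y], because a word having a twin ends in [0] or [s - 1] and branches only
    finitely often whatever [a] is ([finite_branching_other]). For the same
    reason, if [b] branches infinitely often then [b] is the only word of [y].
    Infinitely many free choices then encode an arbitrary real number through
    its rational cut ([card_Qlevel_set]). The one obstacle is that [f_a] reads
    the canonical word only; keeping the sign [-] at every other branching
    position prevents the word from ending in [s - 1], and such a word is the
    canonical one of its value ([Qcanonical_uniq]). *)

(** * Cylinders and words with the same value *)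

Section Cylinders.
Set Implicit Arguments.
Unset Strict Implicit.
Context {R : realType} {s : nat} {q : 'I_s -> nat -> R} (hq : Qstar_matrix q).
Implicit Types (alpha c d : nat -> 'I_s) (i : 'I_s) (m n : nat).

(** [Qbeta] with a natural number in place of the digit, so that [m = s], the
    right end of the last cell, is allowed. *)
Definition cumul (m n : nat) : R := \sum_(k < s | (k < m)%N) q k n.

Lemma cumul0 n : cumul 0 n = 0.
Proof. by rewrite /cumul big_pred0. Qed.

Lemma cumulS i n : cumul i.+1 n = Qbeta q i n + q i n.
Proof.
rewrite /cumul (bigD1 i) //= addrC; congr (_ + _).
by apply: eq_bigl => k; rewrite ltnS ltn_neqAle andbC.
Qed.

Lemma cumul_size n : cumul s n = 1.
Proof. by rewrite -(Qstar_sum1 hq n); apply: eq_bigl => k; rewrite ltn_ord. Qed.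

Lemma le_cumul m m' n : (m <= m')%N -> cumul m n <= cumul m' n.
Proof.
move=> mm'; rewrite /cumul (bigID (fun k : 'I_s => (k < m)%N) (fun k => k < m')%N).
rewrite /= -[leLHS]addr0 lerD //; last first.
  by apply: sumr_ge0 => k _; rewrite ltW // (Qstar_gt0 hq).
rewrite le_eqVlt; apply/orP; left; apply/eqP; apply: eq_bigl => k.
by case: (ltnP k m) => km; rewrite ?andbF // andbT (leq_trans km).
Qed.

Lemma Qbeta_ge0 i n : 0 <= Qbeta q i n.
Proof. by apply: sumr_ge0 => k _; rewrite ltW // (Qstar_gt0 hq). Qed.

Lemma cumul_le1 m n : (m <= s)%N -> cumul m n <= 1.
Proof. by move=> ms; rewrite -(cumul_size n) le_cumul. Qed.

Lemma Qbeta_eq0 i n : Qbeta q i n = 0 -> i = 0%N :> nat.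
Proof.
move=> beta0; apply/eqP; rewrite -leqn0 leqNgt; apply/negP => i_gt0.
pose k := Ordinal (ltn_trans i_gt0 (ltn_ord i)).
have : cumul 1 n <= Qbeta q i n by exact: le_cumul.
rewrite (cumulS k) beta0.
by have := Qstar_gt0 hq k n; have := Qbeta_ge0 k n; lra.
Qed.

Lemma cumulS_eq1 i n : cumul i.+1 n = 1 -> i = s.-1 :> nat.
Proof.
move=> c1; apply/eqP; rewrite eqn_leq; apply/andP; split.
  by rewrite -ltnS (leq_trans (ltn_ord i)) // leqSpred.
rewrite leqNgt; apply/negP => lt_is.
have is1 : (i.+1 < s)%N by lia.
pose k := Ordinal is1.
have := cumul_le1 n (ltn_ord k); rewrite (cumulS k).
have -> : Qbeta q k n = 1 by exact: c1.
by have := Qstar_gt0 hq k n; lra.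
Qed.

Definition left_end alpha : R ^nat :=
  series (fun n => Qbeta q (alpha n) n * \prod_(j < n) q (alpha j) j).

Definition width alpha n : R := \prod_(j < n) q (alpha j) j.

Definition right_end alpha n : R := left_end alpha n + width alpha n.

Lemma width_gt0 alpha n : 0 < width alpha n.
Proof. by apply: prodr_gt0 => j _; exact: (Qstar_gt0 hq). Qed.

Lemma left_end0 alpha : left_end alpha 0 = 0.
Proof. by rewrite /left_end /series /= big_geq. Qed.

Lemma right_end0 alpha : right_end alpha 0 = 1.
Proof. by rewrite /right_end left_end0 /width big_ord0 add0r. Qed.

Lemma left_endS alpha n :
  left_end alpha n.+1 = left_end alpha n + Qbeta q (alpha n) n * width alpha n.
Proof. by rewrite /left_end /series /= big_nat_recr. Qed.

Lemma widthS alpha n : width alpha n.+1 = width alpha n * q (alpha n) n.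
Proof. by rewrite /width big_ord_recr. Qed.

Lemma right_endS alpha n : right_end alpha n.+1 =
  left_end alpha n + cumul (alpha n).+1 n * width alpha n.
Proof. by rewrite /right_end left_endS widthS cumulS; lra. Qed.

Lemma left_end_nondecreasing alpha : nondecreasing_seq (left_end alpha).
Proof.
apply/nondecreasing_seqP => n; rewrite left_endS lerDl mulr_ge0 ?Qbeta_ge0 //.
exact: ltW (width_gt0 _ _).
Qed.

Lemma right_end_nonincreasing alpha : nonincreasing_seq (right_end alpha).
Proof.
apply/nonincreasing_seqP => n; rewrite right_endS lerD2l.
by rewrite ger_pMl ?width_gt0 // cumul_le1.
Qed.

Lemma width_cvg0 alpha : width alpha @ \oo --> (0 : R).
Proof.
apply: (squeeze_cvgr _ (cvg_cst 0) (Qstar_prod_max hq)).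
apply: nearW => n; rewrite (ltW (width_gt0 _ _)) /= /width.
apply: ler_prod => j _; rewrite (ltW (Qstar_gt0 hq _ _)) /=.
by rewrite (bigD1 (alpha j)) //= le_max lexx.
Qed.

Lemma left_end_cvg alpha : left_end alpha @ \oo --> Qdelta q alpha.
Proof.
apply: nondecreasing_is_cvgn; first exact: left_end_nondecreasing.
exists 1 => _ [n _ <-].
rewrite -(right_end0 alpha) (le_trans _ (right_end_nonincreasing alpha (leq0n n))) //.
by rewrite lerDl ltW // width_gt0.
Qed.

Lemma right_end_cvg alpha : right_end alpha @ \oo --> Qdelta q alpha.
Proof.
rewrite -[Qdelta q alpha]addr0; apply: cvgD.
  exact: left_end_cvg.
exact: width_cvg0.
Qed.

Lemma left_end_le alpha n : left_end alpha n <= Qdelta q alpha.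
Proof.
apply: nondecreasing_cvgn_le; first exact: left_end_nondecreasing.
by apply/cvg_ex; exists (Qdelta q alpha); exact: left_end_cvg.
Qed.

Lemma le_right_end alpha n : Qdelta q alpha <= right_end alpha n.
Proof.
rewrite -(cvg_lim _ (@right_end_cvg alpha)) //.
apply: nonincreasing_cvgn_ge; first exact: right_end_nonincreasing.
by apply/cvg_ex; exists (Qdelta q alpha); exact: right_end_cvg.
Qed.

Lemma Qdelta_in01 alpha : 0 <= Qdelta q alpha <= 1.
Proof. by rewrite -{1}(left_end0 alpha) -(right_end0 alpha) left_end_le le_right_end. Qed.

(** [left_end] is nondecreasing and tends to [Qdelta], so it is constant from
    [m] on, which makes every later term [Qbeta (alpha n) n] vanish. *)
Lemma Qdelta_left_end alpha m :
  Qdelta q alpha = left_end alpha m -> forall n, (m <= n)%N -> alpha n = 0%N :> nat.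
Proof.
move=> Dm n mn; apply: (@Qbeta_eq0 _ n).
have := left_end_le alpha n.+1; rewrite Dm left_endS.
have := left_end_nondecreasing alpha mn.
have := width_gt0 alpha n; have := Qbeta_ge0 (alpha n) n; nra.
Qed.

(** Mirror image of the previous lemma: [right_end] no longer decreases, so
    every later digit owns the last cell. *)
Lemma Qdelta_right_end alpha m :
  Qdelta q alpha = right_end alpha m -> forall n, (m <= n)%N -> alpha n = s.-1 :> nat.
Proof.
move=> Dm n mn; apply: (@cumulS_eq1 _ n).
have := le_right_end alpha n.+1; rewrite Dm right_endS.
have := right_end_nonincreasing alpha mn; rewrite /(right_end alpha n).
have := width_gt0 alpha n; have := cumul_le1 n (ltn_ord (alpha n)); nra.
Qed.

Lemma eq_left_end c d m : (forall n, (n < m)%N -> c n = d n) ->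
  left_end c m = left_end d m /\ width c m = width d m.
Proof.
elim: m => [|m IH] cd; first by rewrite !left_end0 /width !big_ord0.
have [|l w] := IH; first by move=> n nm; apply: cd; rewrite ltnS ltnW.
by rewrite !left_endS !widthS l w cd.
Qed.

(** The shape of the two expansions of a binary number, [c] being the one with
    period [s - 1]. *)
Definition twin c d := exists m,
  [/\ (c m < d m)%N, forall n, (m < n)%N -> c n = s.-1 :> nat
   & forall n, (m < n)%N -> d n = 0%N :> nat].

(** At the first difference the two words enter different cells of the same
    interval, the lower one lying to the left of the upper one. Equality of the
    values forces the lower word to the right end of its cell and the upper
    word to the left end. *)
Lemma Qdelta_eq_twin c d : Qdelta q c = Qdelta q d -> c <> d ->
  twin c d \/ twin d c.
Proof.
have first_diff m c' d' : (forall n, (n < m)%N -> c' n = d' n) ->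
    (c' m < d' m)%N -> Qdelta q c' = Qdelta q d' -> twin c' d'.
  move=> agree lt_m eqD; have [eql eqw] := eq_left_end agree.
  have ends : right_end c' m.+1 <= left_end d' m.+1.
    rewrite right_endS left_endS eql eqw lerD2l ler_pM2r ?width_gt0 //.
    exact: le_cumul.
  have cr := le_right_end c' m.+1; have dl := left_end_le d' m.+1.
  exists m; split => // n mn.
    by apply: (@Qdelta_right_end _ m.+1) => //; lra.
  by apply: (@Qdelta_left_end _ m.+1) => //; lra.
move=> eqD neq.
have diff : exists m, c m != d m.
  apply: contra_notP neq => /forallNP eqcd; apply: funext => n.
  by move: (eqcd n) => /negP/negPn/eqP.
case: (ex_minnP diff) => m neq_m min_m.
have agree n : (n < m)%N -> c n = d n.
  by move=> nm; apply: contraTeq nm => /min_m; rewrite -leqNgt.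
case: (ltngtP (c m) (d m)) => [lt_m|gt_m|/val_inj eq_m].
- by left; exact: first_diff lt_m eqD.
- right; apply: first_diff gt_m _; last by rewrite eqD.
  by move=> n nm; rewrite agree.
- by rewrite eq_m eqxx in neq_m.
Qed.

Lemma next_digit n (r : R) : 0 <= r <= 1 ->
  exists i, Qbeta q i n <= r <= Qbeta q i n + q i n.
Proof.
case/andP=> r0 r1.
have ex : exists m, r <= cumul m.+1 n.
  by exists s; rewrite (le_trans r1) // -(cumul_size n) le_cumul.
case: (ex_minnP ex) => m rm min_m.
have ms : (m < s)%N.
  have : r <= cumul s.-1.+1 n.
    by rewrite (le_trans r1) // -(cumul_size n) le_cumul // leqSpred.
  move/min_m => ms1; apply: leq_ltn_trans ms1 _; case: (posnP s) => [s0|]; last by lia.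
  have : cumul s n = 0 by rewrite /cumul; apply: big1 => k; have := ltn_ord k; lia.
  by rewrite cumul_size => /eqP; rewrite oner_eq0.
exists (Ordinal ms); rewrite -cumulS rm andbT.
rewrite /Qbeta -/(cumul m n) /=.
case: m rm min_m {ms} => [|m] rm min_m; first by rewrite cumul0.
by rewrite ltW // ltNge; apply/negP => /min_m; rewrite ltnn.
Qed.

(** Greedy expansion: [rem n] is the position of [x] relative to the interval of
    generation [n], rescaled to [[0, 1]]. *)
Lemma Qdelta_surj (x : R) : 0 <= x <= 1 -> exists alpha, Qdelta q alpha = x.
Proof.
move=> x01.
have [i0 _] := next_digit 0 x01.
pose digit n r := xget i0 [set i | Qbeta q i n <= r <= Qbeta q i n + q i n].
pose rem := fix rem n := if n is n'.+1 then
  (rem n' - Qbeta q (digit n' (rem n')) n') / q (digit n' (rem n')) n' else x.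
have digitP n r : 0 <= r <= 1 ->
    Qbeta q (digit n r) n <= r <= Qbeta q (digit n r) n + q (digit n r) n.
  by move=> /(next_digit n); exact: xgetPex.
have rem01 n : 0 <= rem n <= 1.
  elim: n => //= n /(digitP n) /andP[lo hi].
  have q0 := Qstar_gt0 hq (digit n (rem n)) n.
  by rewrite divr_ge0 ?subr_ge0 ?(ltW q0) //= ler_pdivrMr //; lra.
pose alpha n := digit n (rem n); exists alpha.
have inv n : x = left_end alpha n + width alpha n * rem n.
  elim: n => [|n IH]; first by rewrite left_end0 /width big_ord0 add0r mul1r.
  rewrite left_endS widthS /= -/(alpha n) {1}IH.
  have q0 := Qstar_gt0 hq (alpha n) n.
  rewrite -mulrA [q _ _ * _]mulrC divfK ?gt_eqF //; lra.
apply: le_anti; apply/andP; split.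
  rewrite -(cvg_lim _ (@left_end_cvg alpha)) //; apply: limr_le.
    by apply/cvg_ex; eexists; exact: left_end_cvg.
  apply: nearW => n; rewrite {1}(inv n) lerDl mulr_ge0 ?(ltW (width_gt0 _ _)) //.
  by case/andP: (rem01 n).
rewrite -(cvg_lim _ (@right_end_cvg alpha)) //; apply: limr_ge.
  by apply/cvg_ex; eexists; exact: right_end_cvg.
apply: nearW => n; rewrite {1}(inv n) lerD2l ger_pMr ?width_gt0 //.
by case/andP: (rem01 n).
Qed.

Lemma Qcanonical_ex (x : R) : 0 <= x <= 1 -> exists alpha, Qcanonical q x alpha.
Proof.
move=> /Qdelta_surj[alpha Dx].
have [[d [Dd [m [_ d0]]]]|nb] := pselect (Qbinary q x); last by exists alpha.
by exists d; split => // _; exists m.+1.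
Qed.

Definition ends_in (v : nat) alpha :=
  exists m, forall n, (m <= n)%N -> alpha n = v :> nat.

(** A different word with the same value would be the twin of [alpha] ending in
    [s - 1], while [alpha] shows that the value is binary, so that this twin is
    not canonical. *)
Lemma Qcanonical_uniq alpha c : (1 < s)%N -> ~ ends_in s.-1 alpha ->
  Qcanonical q (Qdelta q alpha) c -> c = alpha.
Proof.
move=> s1 ntop [Dc bin]; apply: contra_notP ntop => neq.
case: (Qdelta_eq_twin Dc neq) => -[m [lt_m ctop a0]]; last by exists m.+1.
have [|k c0] := bin.
  by exists alpha; split => //; exists m; split => //; exact: leq_ltn_trans lt_m.
have := c0 _ (leq_maxl k m.+1); rewrite ctop ?leq_maxr //; lia.
Qed.

Lemma Qcanonical_ntop alpha : ~ ends_in s.-1 alpha ->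
  Qcanonical q (Qdelta q alpha) alpha.
Proof.
move=> ntop; split => // -[d [Dd [m [_ d0]]]].
have [<-|neq] := pselect (d = alpha); first by exists m.+1.
case: (Qdelta_eq_twin Dd neq) => -[k [_ top zero]]; first by exists k.+1.
by case: ntop; exists k.+1.
Qed.

(** Existence of a canonical word keeps the default value of [xget] in [Qf] from
    interfering. *)
Lemma Qlevel_set_word (a : nat -> 'I_s) (y x : R) : Qlevel_set q a y x ->
  exists alpha, Qdelta q alpha = x /\
    Qdelta q (fun n => digit_dist (a n) (alpha n)) = y.
Proof.
case=> x01 fx; exists (xget a (Qcanonical q x)); split => //.
by have [] : Qcanonical q x (xget a (Qcanonical q x)) := xgetPex a (Qcanonical_ex x01).
Qed.

Lemma Qlevel_set_ntop (a : nat -> 'I_s) alpha : (1 < s)%N -> ~ ends_in s.-1 alpha ->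
  Qlevel_set q a (Qdelta q (fun n => digit_dist (a n) (alpha n))) (Qdelta q alpha).
Proof.
move=> s1 ntop; split; first exact: Qdelta_in01.
rewrite /Qf (_ : xget a _ = alpha) //; apply: Qcanonical_uniq => //.
by apply: xgetI; exact: Qcanonical_ntop.
Qed.

End Cylinders.

(** * Solving |a - alpha| = c digit by digit *)

Section Branching.
Set Implicit Arguments.
Unset Strict Implicit.
Context {s : nat}.
Implicit Types (a c alpha : nat -> 'I_s) (i j k : 'I_s).

Lemma is_digit_add i j : is_digit s (i%:Z + j%:Z) = (i + j < s)%N.
Proof. by rewrite /is_digit; lia. Qed.

Lemma is_digit_sub i j : is_digit s (i%:Z - j%:Z) = (j <= i)%N.
Proof. by have := ltn_ord i; rewrite /is_digit; lia. Qed.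

Lemma digit_dist_eq i j k : (digit_dist i j == k) =
  (j == i + k :> nat)%N || (i == j + k :> nat)%N.
Proof. by rewrite -val_eqE /=; apply/idP/idP; lia. Qed.

Definition branching a c : set nat :=
  [set n | [/\ c n <> 0%N :> nat, is_digit s ((a n)%:Z + (c n)%:Z) &
               is_digit s ((a n)%:Z - (c n)%:Z)]].

(** Off the branching positions [alpha n] is determined by [a n] and [c n], so
    [alpha] is determined by its restriction to a finite set. *)
Lemma finite_digit_dist_fiber a c : finite_set (branching a c) ->
  finite_set [set alpha | (fun n => digit_dist (a n) (alpha n)) = c].
Proof.
move=> /finite_seqP[X BX].
pose restrict alpha : {ffun seq_sub X -> 'I_s} := [ffun n => alpha (ssval n)].
set F := [set _ | _].
have inj : {in F &, injective restrict}.
  move=> u v /set_mem uF /set_mem vF /ffunP uv; apply: funext => n.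
  have [Bn|nB] := pselect (branching a c n).
    have nX : n \in X by move: Bn; rewrite BX.
    by have := uv (SeqSub nX); rewrite !ffunE.
  have /eqP := congr1 (@^~ n) uF; have /eqP := congr1 (@^~ n) vF.
  rewrite /= !digit_dist_eq => eqv equ; apply: val_inj => /=.
  have := ltn_ord (u n); have := ltn_ord (v n) => ? ?.
  case: (eqVneq (u n : nat) (v n : nat)) => // neq.
  case: nB; rewrite /branching /= is_digit_add is_digit_sub; split; lia.
rewrite -(eq_finite_set (inj_card_eq inj)); exact: finite_finset.
Qed.

(** Starting from one solution [alpha], the solution whose sign at each branching
    position is prescribed. The guard keeps the chosen value below [s], so the
    default of [insubd] is never reached. *)
Definition branch a alpha (sign : nat -> bool) n : 'I_s :=
  let c := digit_dist (a n) (alpha n) in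
  if `[< branching a (fun n => digit_dist (a n) (alpha n)) n >] then
    insubd (a n) (if sign n then a n + c else a n - c)%N
  else alpha n.

Lemma branch_val a alpha sign n :
  branching a (fun n => digit_dist (a n) (alpha n)) n ->
  branch a alpha sign n =
    (if sign n then a n + digit_dist (a n) (alpha n)
     else a n - digit_dist (a n) (alpha n))%N :> nat.
Proof.
move=> Bn; rewrite /branch asboolT //.
case: Bn; rewrite is_digit_add is_digit_sub => _ ad _.
rewrite val_insubd; case: ifP => // /negP[]; case: (sign n) => //.
exact: leq_ltn_trans (leq_subr _ _) (ltn_ord _).
Qed.

Lemma digit_dist_branch a alpha sign n :
  digit_dist (a n) (branch a alpha sign n) = digit_dist (a n) (alpha n).
Proof.
have [Bn|nB] := pselect (branching a (fun n => digit_dist (a n) (alpha n)) n).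
  have := branch_val sign Bn; case: Bn; rewrite is_digit_add is_digit_sub.
  move: (digit_dist _ (alpha n)) => c _ _ ca bn; apply/eqP.
  by rewrite digit_dist_eq; case: (sign n) bn; lia.
by rewrite /branch asboolF.
Qed.

Lemma branch_inj a alpha sign sign' n :
  branching a (fun n => digit_dist (a n) (alpha n)) n ->
  branch a alpha sign n = branch a alpha sign' n -> sign n = sign' n.
Proof.
move=> Bn /(congr1 val) /=; rewrite !branch_val //.
case: Bn; rewrite is_digit_sub; case: (sign n); case: (sign' n) => //; lia.
Qed.

End Branching.

(** * Real numbers as bit sequences *)

Section RationalCuts.
Context {R : realType}.

Definition rat_cut (x : R) (k : nat) : bool :=
  if unpickle k is Some r then ratr (r : rat) < x else false.

Lemma rat_cut_inj : injective rat_cut.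
Proof.
have lt_cut x y : x < y -> rat_cut x <> rat_cut y.
  move=> /rat_in_itvoo[r]; rewrite in_itv /= => /andP[xr ry].
  move=> /(congr1 (@^~ (pickle r))); rewrite /rat_cut pickleK ry.
  by rewrite ltNge ltW.
move=> x y exy; case: (ltgtP x y) => // /lt_cut; first by move=> /(_ exy).
by rewrite exy.
Qed.

End RationalCuts.

(** * Level sets *)

Section LevelSets.
Set Implicit Arguments.
Unset Strict Implicit.
Context {R : realType} {s : nat} {q : 'I_s -> nat -> R} (hq : Qstar_matrix q).
Context (s_gt1 : (1 < s)%N).
Implicit Types (a c d alpha : nat -> 'I_s) (y : R).

(** A digit [c n = 0] offers no choice, and [c n = s - 1] would need both
    [a n = 0] and [a n = s - 1]. *)
Lemma finite_branching_ends a c v : v = 0%N \/ v = s.-1 -> ends_in v c ->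
  finite_set (branching a c).
Proof.
move=> v0s [m cv]; apply: sub_finite_set (finite_II m) => n.
rewrite /branching /= is_digit_add is_digit_sub => -[c0 ac ca].
rewrite ltnNge; apply/negP => /cv.
by case: v0s => ->; lia.
Qed.

Lemma twin_ends c d : twin c d -> ends_in s.-1 c /\ ends_in 0 d.
Proof. by case=> m [_ ctop d0]; split; exists m.+1. Qed.

Lemma ends_in_uniq v w c : ends_in v c -> ends_in w c -> v = w.
Proof.
move=> [m cv] [k cw].
by rewrite -(cv (maxn m k) (leq_maxl _ _)) (cw (maxn m k) (leq_maxr _ _)).
Qed.

Lemma finite_branching_other a c d : Qdelta q c = Qdelta q d -> c <> d ->
  finite_set (branching a c).
Proof.
move=> eqD neq; case: (Qdelta_eq_twin hq eqD neq) => /twin_ends[top zero].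
  exact: finite_branching_ends (or_intror erefl) top.
exact: finite_branching_ends (or_introl erefl) zero.
Qed.

(** Being twins pairs a word ending in [0] with one ending in [s - 1], so three
    words cannot be pairwise twins. *)
Lemma finite_Qdelta_fiber y : finite_set [set c | Qdelta q c = y].
Proof.
have s0 : 0%N <> s.-1 by lia.
have [[c [d [cy dy neq]]]|uniq] := pselect (exists c d,
    [/\ Qdelta q c = y, Qdelta q d = y & c <> d]); last first.
  have [->|/set0P[c cy]] := eqVneq [set c | Qdelta q c = y] set0.
    exact: finite_set0.
  apply: sub_finite_set (finite_set1 c) => d dy /=.
  by apply: contra_notP uniq => neq; exists d, c.
apply: sub_finite_set (finite_set2 c d) => e /= ey; apply: contrapT.
move=> /not_orP[ec ed].
have twins u v : Qdelta q u = y -> Qdelta q v = y -> u <> v ->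
    (ends_in s.-1 u /\ ends_in 0 v) \/ (ends_in s.-1 v /\ ends_in 0 u).
  move=> uy vy uv; have uvD : Qdelta q u = Qdelta q v by rewrite uy.
  by case: (Qdelta_eq_twin hq uvD uv) => /twin_ends; [left|right].
have excl (u : nat -> 'I_s) : ends_in s.-1 u -> ends_in 0 u -> False.
  by move=> top zero; apply: s0; exact: ends_in_uniq zero top.
case: (twins _ _ cy dy neq) => -[]; case: (twins _ _ ey cy ec) => -[];
case: (twins _ _ ey dy ed) => -[];
(* [e] is a twin of both [c] and [d], which end differently. *)
move=> *; match goal with
| top : ends_in s.-1 ?u, zero : ends_in 0 ?u |- _ => exact: excl top zero
end.
Qed.

Lemma finite_Qlevel_set a y :
  (forall c, Qdelta q c = y -> finite_set (branching a c)) ->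
  finite_set (Qlevel_set q a y).
Proof.
move=> fin.
apply: (@sub_finite_set _ _ (Qdelta q @` \bigcup_(c in [set c | Qdelta q c = y])
    [set alpha | (fun n => digit_dist (a n) (alpha n)) = c])).
  move=> x /(Qlevel_set_word hq)[alpha [<- Dy]]; exists alpha => //.
  by exists (fun n => digit_dist (a n) (alpha n)).
apply: finite_image; apply: bigcup_finite; first exact: finite_Qdelta_fiber.
by move=> c /fin; exact: finite_digit_dist_fiber.
Qed.

Lemma Qlevel_set_branch a alpha sign :
  ~ ends_in s.-1 (branch a alpha sign) ->
  Qlevel_set q a (Qdelta q (fun n => digit_dist (a n) (alpha n)))
    (Qdelta q (branch a alpha sign)).
Proof.
move=> ntop; have := Qlevel_set_ntop hq a s_gt1 ntop.
by under [X in Qdelta q X]eq_fun do rewrite digit_dist_branch.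
Qed.

(** Along an injective enumeration [g] of branching positions, the even ranks
    carry the bits of a rational cut and the odd ranks the constant sign [-].
    At odd ranks a nonzero amount is subtracted from [a n], so the digit is below
    [s - 1]: the word does not end in [s - 1], so its value lies in the level set and
    determines the word. *)
Lemma card_Qlevel_set a alpha :
  infinite_set (branching a (fun n => digit_dist (a n) (alpha n))) ->
  (Qlevel_set q a (Qdelta q (fun n => digit_dist (a n) (alpha n))) #= [set: R])%card.
Proof.
move=> infB; set L := Qlevel_set _ _ _.
have /infiniteP/pcard_leP/unsquash g := infB.
have ginj m n : g m = g n -> m = n by apply: inj; rewrite in_setT.
have gB m : branching a (fun n => digit_dist (a n) (alpha n)) (g m) by exact: funS.
pose idx n := xget 0%N [set m | g m = n].
have gK m : idx (g m) = m by
  apply: ginj; exact: (@xgetPex _ 0%N [set k | g k = g m] (ex_intro _ m erefl)).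
pose sign (x : R) n := if odd (idx n) then false else rat_cut x (idx n)./2.
have ntop x : ~ ends_in s.-1 (branch a alpha (sign x)).
  move=> [N top].
  (* [g] need not increase: that it leaves [0, N) comes from injectivity. *)
  have low m : (g m.*2.+1 < N)%N.
    rewrite ltnNge; apply/negP => /top; rewrite branch_val //.
    rewrite /sign gK oddS odd_double.
    case: (gB m.*2.+1); rewrite is_digit_sub.
    move: (digit_dist _ _) => c; have := ltn_ord (a (g m.*2.+1)) => /=.
    by lia.
  have : finite_set (range (fun m : nat => g m.*2.+1)).
    by apply: sub_finite_set (finite_II N) => _ [m _ <-]; exact: low.
  have ginj2 : {in [set: nat] &, injective (fun m : nat => g m.*2.+1)}.
    by move=> m n _ _ /ginj; lia.
  by rewrite (eq_finite_set (inj_card_eq ginj2)); exact: infinite_nat.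
have Finj : injective (fun x => Qdelta q (branch a alpha (sign x))).
  move=> x y eqD; apply: rat_cut_inj; apply: funext => k.
  have : branch a alpha (sign x) = branch a alpha (sign y).
    apply: contrapT => neq.
    by case: (Qdelta_eq_twin hq eqD neq) => /twin_ends[/ntop].
  move=> /(congr1 (@^~ (g k.*2))) /branch_inj-/(_ (gB _)).
  by rewrite /sign gK odd_double doubleK.
apply/card_eqPle; split; first exact: card_leT.
apply: (@card_le_trans _ _ _ (range (fun x => Qdelta q (branch a alpha (sign x))))).
  have Finj2 : {in [set: R] &, injective (fun x => Qdelta q (branch a alpha (sign x)))}.
    by move=> x y _ _ /Finj.
  by have /card_esym/card_eqPle[] := inj_card_eq Finj2.
by apply: subset_card_le => _ [x _ <-]; exact: Qlevel_set_branch.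
Qed.

End LevelSets.

(** * The three regimes of a level set *)

Theorem theorem4 (R : realType) (s : nat) (hs : (2 < s)%N)
    (q : 'I_s -> nat -> R) (hq : Qstar_matrix q)
    (a b : nat -> 'I_s) (y0 : R) (hy0 : y0 = Qdelta q b) :
  [/\ (forall b' : nat -> 'I_s, Qdelta q b' = y0 ->
         exists n, b' n = (s - 1)%N :> nat /\ (1 <= a n <= s - 2)%N) ->
      Qlevel_set q a y0 = set0,
      finite_set [set n | is_digit s ((a n)%:Z + (b n)%:Z) /\
                          is_digit s ((a n)%:Z - (b n)%:Z)] \/
      (forall n, b n = 0%N :> nat) ->
      finite_set (Qlevel_set q a y0)
    & infinite_set [set n | [/\ b n <> 0%N :> nat,
                                is_digit s ((a n)%:Z + (b n)%:Z) &
                                is_digit s ((a n)%:Z - (b n)%:Z)]] ->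
      Qlevel_set q a y0 !=set0 ->
      (Qlevel_set q a y0 #= [set: R])%card].
Proof.
have s1 : (1 < s)%N by exact: ltnW.
split.
- move=> far; rewrite -subset0 => x /(Qlevel_set_word hq)[alpha [_ /far[n []]]] /=.
  by have := ltn_ord (alpha n); lia.
- move=> fin; apply: (finite_Qlevel_set hq s1) => c cy.
  have [->|neq] := pselect (c = b); last first.
    by apply: (finite_branching_other hq s1 a _ neq); rewrite cy.
  case: fin => [|b0]; first by apply: sub_finite_set => n [].
  by rewrite (_ : branching a b = set0) // -subset0 => n [] /(_ (b0 n)).
- rewrite -/(branching a b) => infB [x /(Qlevel_set_word hq)[alpha [_ Dy]]].
  have eqb : (fun n => digit_dist (a n) (alpha n)) = b.
    apply: contrapT => neq; apply: infB.
    have eqD : Qdelta q b = Qdelta q (fun n => digit_dist (a n) (alpha n)).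
      by rewrite Dy hy0.
    exact: (finite_branching_other hq s1 a eqD (nesym neq)).
  by rewrite -Dy; apply: (card_Qlevel_set hq s1); rewrite eqb.
Qed.
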